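(* Let $L(\lambda)=I_n\lambda^3+aI_n\lambda^2+bT\lambda+cT$, where $a,b,c>0$ are real and $T\in\mathbb C^{n,n}$ is Hermitian positive definite. If $a>1$ and $b>c$, then all eigenvalues of $L(\lambda)$ (i.e. all $\lambda_0\in\mathbb C$ with $\det L(\lambda_0)=0$) lie in the closed left half-plane.
   Context: $I_n$ is the $n\times n$ identity matrix. *)

(* Defs.v *)
From mathcomp Require Import all_boot all_order all_algebra.
From mathcomp Require Import reals.
From mathcomp Require Import complex.
Set Implicit Arguments.
Unset Strict Implicit.
Unset Printing Implicit Defensive.
Import Order.TTheory GRing.Theory Num.Theory.
Local Open Scope ring_scope.
Local Open Scope complex_scope.
Local Open Scope sesquilinear_scope.

(* In R[i], [0 < z] means that z is real and positive. *)
Definition hermitian_posdef (R : realType) (n : nat) (T : 'M[R[i]]_n) : Prop :=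
  T \is hermsymmx /\
  forall x : 'cV[R[i]]_n, x != 0 -> 0 < (x ^t* *m T *m x) 0 0.

Definition cubic_mxpoly (R : realType) (n : nat) (a b c : R)
    (T : 'M[R[i]]_n) (z : R[i]) : 'M[R[i]]_n :=
  z ^+ 3 *: 1%:M + (a%:C * z ^+ 2) *: 1%:M + (b%:C * z) *: T + c%:C *: T.

Definition mxpoly_eigenvalue (R : realType) (n : nat)
    (L : R[i] -> 'M[R[i]]_n) (z : R[i]) : Prop :=
  \det (L z) = 0.

Definition closed_left_half_plane (R : realType) (z : R[i]) : Prop :=
  complex.Re z <= 0.

(* Main.v *)
Require Import Defs.
From mathcomp Require Import all_boot all_order all_algebra.
From mathcomp Require Import reals.
From mathcomp Require Import complex.
From mathcomp Require Import ring lra.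
Import Order.TTheory GRing.Theory Num.Theory.
Local Open Scope ring_scope.
Local Open Scope complex_scope.
Local Open Scope sesquilinear_scope.

(** A vector [v] in the kernel of [L z] turns the matrix equation into a scalar
    one: evaluating the form [v *m L z *m v^t*] gives
    [N z^3 + a N z^2 + b t z + c t = 0], where [N = v v^*] and [t = v T v^*]
    are positive reals, the second one because [T] is positive definite.
    The Routh-Hurwitz condition for this cubic, [(a N) (b t) > N (c t)],
    reduces to [a b > c], which follows from [a > 1] and [b > c]; so all its
    roots, [z] among them, have negative real part.  Since [v] is a row, the column to
    which positive definiteness applies is [v^t*]. *)

(** The Routh-Hurwitz criterion in degree three.  The inequality
    [p s < q r] also forces [r > 0], so all four coefficients are positive and a
    real root is negative.  For a nonreal root [z = u + i v] the imaginary part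
    of the equation gives [p v^2 = 3 p u^2 + 2 q u + r]; eliminating [v^2]
    from the real part leaves
    [8 p^2 u^3 + 8 p q u^2 + 2 (q^2 + p r) u + (q r - p s) = 0], whose
    coefficients are all positive, so that [u < 0]. *)
Lemma routh_hurwitz_cubic (R : rcfType) (p q r s : R) (z : R[i]) :
  0 < p -> 0 < q -> 0 < s -> p * s < q * r ->
  p%:C * z ^+ 3 + q%:C * z ^+ 2 + r%:C * z + s%:C = 0 ->
  complex.Re z < 0.
Proof.
case: z => u v p0 q0 s0 psqr /eqP.
have r0 : 0 < r by rewrite -(pmulr_rgt0 _ q0) (lt_trans _ psqr) ?mulr_gt0.
rewrite !exprS expr0 mulr1 eq_complex /= => /andP[/eqP re0 /eqP im0].
rewrite ltNge; apply/negP => u0.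
have imE : v * (3 * p * u ^+ 2 + 2 * q * u + r - p * v ^+ 2) = 0.
  by rewrite -[RHS]im0; ring.
have reE : p * u ^+ 3 - 3 * u * (p * v ^+ 2) + q * u ^+ 2 - q * v ^+ 2
           + r * u + s = 0.
  by rewrite -[RHS]re0; ring.
have u2 : 0 <= u ^+ 2 by rewrite exprn_ge0.
have u3 : 0 <= u ^+ 3 by rewrite exprn_ge0.
have pu3 := mulr_ge0 (ltW p0) u3.
have qu2 := mulr_ge0 (ltW q0) u2.
have ru := mulr_ge0 (ltW r0) u0.
move/eqP: imE; rewrite mulf_eq0 => /orP[/eqP v0|/eqP vE].
  by move: reE; rewrite v0 expr0n /= !mulr0 !subr0; lra.
have elim_v : 8 * (p * (p * u ^+ 3)) + 8 * (p * (q * u ^+ 2))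
    + 2 * (q ^+ 2 * u) + 2 * (p * (r * u)) + (q * r - p * s) = 0.
  have pv2 : p * v ^+ 2 = 3 * p * u ^+ 2 + 2 * q * u + r by lra.
  have := congr1 (fun x => p * x) reE; rewrite mulr0.
  rewrite (_ : p * _ = p * (p * u ^+ 3 + q * u ^+ 2 + r * u + s)
    - (3 * p * u + q) * (p * v ^+ 2)); last by ring.
  rewrite pv2 => /eqP; rewrite -oppr_eq0 => /eqP <-; ring.
have := mulr_ge0 (ltW p0) pu3; have := mulr_ge0 (ltW p0) qu2.
have := mulr_ge0 (ltW p0) ru; have := mulr_ge0 (exprn_ge0 2 (ltW q0)) u0.
lra.
Qed.

Lemma gt0_complexE (R : rcfType) (w : R[i]) :
  0 < w -> exists2 x : R, 0 < x & w = x%:C.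
Proof. by case: w => x y; rewrite ltcE /= => /andP[/eqP -> x0]; exists x. Qed.

Theorem corollary6p10 (R : realType) (n : nat) (a b c : R) (T : 'M[R[i]]_n)
    (ha : 0 < a) (hb : 0 < b) (hc : 0 < c)
    (hT : hermitian_posdef T)
    (ha1 : 1 < a) (hbc : c < b) :
  forall z : R[i], mxpoly_eigenvalue (cubic_mxpoly a b c T) z ->
    closed_left_half_plane z.
Proof.
move=> z /eqP/det0P[v v0 vL].
have [N N0] := gt0_complexE _ _ (dotmx_is_dotmx v0); rewrite dotmxE => NE.
have vstar0 : v^t* != 0.
  by apply: contraNneq v0 => vt0; rewrite -[v]trmxCK vt0 trmx0 map_mx0.
have [t t0 tE] := gt0_complexE _ _ (hT.2 _ vstar0).
rewrite trmxCK in tE.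
apply/ltW/(routh_hurwitz_cubic _ N (a * N) (b * t) (c * t)).
- by [].
- exact: mulr_gt0.
- exact: mulr_gt0.
- have cab : c < a * b by nra.
  have := mulr_gt0 N0 t0; nra.
have := congr1 (fun w => (w *m v^t*) 0 0) vL.
rewrite /cubic_mxpoly !mulmxDr !mulmxDl -!scalemxAr -!scalemxAl !mulmx1 mul0mx.
move: NE tE; rewrite !mxE => -> -> <-.
by rewrite !rmorphM /=; ring.
Qed.
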